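(* Let $\mathcal{A}$ be $\mathcal{C}_n$, $\mathcal{H}_n$ or $\mathbf{\Gamma}_n$; in other words, let $\mathcal{A} = \mathbb{R}[k]/\langle k^n - a\rangle$ be a principal algebra with generator $k$ such that $k^n = a$ for some $a\in\mathbb{R}$. Let $z \in \mathrm{Ld}(\mathcal{A})$ and let $z = \rho\, e^{k\theta_1 + k^2\theta_2 + \dots + k^{n-1}\theta_{n-1}}$ be a representation of $z$ in generalized polar form. Then $\rho$ is the unique positive real number satisfying $F(z) = \rho^n$, and hence $\rho = \sqrt[n]{F(z)}$.
   Context: $\mathcal{H}_n = \mathbb{R}[j]/\langle j^n-1\rangle$, $\mathcal{C}_n = \mathbb{R}[i]/\langle i^n+1\rangle$, $\mathbf{\Gamma}_n = \mathbb{R}[\epsilon]/\langle\epsilon^n\rangle$, with generators $k=j,i,\epsilon$ respectively. The exponential on $\mathcal{A}$ is $e^z = \sum_{m=0}^\infty z^m/m!$, and $\mathrm{Ld}(\mathcal{A})$ (the logarithmic domain) is the image of $\exp:\mathcal{A}\to\mathcal{A}$. Every $z\in\mathrm{Ld}(\mathcal{A})$ has the form $z = e^{x_1 + k\theta_1+\dots+k^{n-1}\theta_{n-1}}$ with $x_1,\theta_1,\dots,\theta_{n-1}\in\mathbb{R}$; a representation of $z$ in generalized polar form is an expression $z = \rho e^{k\theta_1+\dots+k^{n-1}\theta_{n-1}}$ with $\rho = e^{x_1}$ a positive real and $\theta_1,\dots,\theta_{n-1}\in\mathbb{R}$. With the basis $\beta=\{1,k,\dots,k^{n-1}\}$, $M_\beta(z)$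 is the matrix with respect to $\beta$ of left-multiplication $x\mapsto zx$, and $F(z) = \det(M_\beta(z))$. *)

(* Defs.v *)
From HB Require Import structures.
From mathcomp Require Import all_boot all_order all_algebra.
From mathcomp Require Import all_classical all_reals all_analysis.

Set Implicit Arguments.
Unset Strict Implicit.
Unset Printing Implicit Defensive.

Import Order.TTheory GRing.Theory Num.Theory.
Import numFieldNormedType.Exports.
Local Open Scope classical_set_scope.
Local Open Scope ring_scope.

(* R[k]/<k^n - a>. For n = 0 the polynomial 'X^n - a%:P is constant and
   {poly %/ _} silently falls back to R[X]/<X>, so 0 < n has to be assumed.
   C_n, H_n and Gamma_n are the cases a = -1, a = 1 and a = 0. *)
Notation palg n a := {poly %/ ('X^n - a%:P)}.

Section PrincipalAlgebra.
Variables (R : realType) (n : nat) (a : R).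

Definition pgen : palg n a := 'qX.

Definition pbasis : n.-tuple (palg n a) := [tuple pgen ^+ i | i < n].

Definition pcoords (z : palg n a) : 'rV[R]_n := \row_(i < n) coord pbasis i z.

(* The algebra carries no library topology: the series is summed in the
   normed space of coordinate vectors. *)
Definition pexp (z : palg n a) : palg n a :=
  let s := limn (fun N : nat =>
             pcoords (series (fun m : nat => m`!%:R^-1 *: z ^+ m) N)) in
  \sum_(i < n) s 0 i *: tnth pbasis i.

Definition Ld : set (palg n a) := range pexp.

Definition polar_form (z : palg n a) (rho : R) (theta : 'I_n.-1 -> R) : Prop :=
  0 < rho /\ z = rho *: pexp (\sum_(i < n.-1) theta i *: pgen ^+ i.+1).

(* Column j holds the coordinates of z k^j. *)
Definition mulmat (z : palg n a) : 'M[R]_n :=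
  \matrix_(i, j) coord pbasis i (z * tnth pbasis j).

Definition pdet (z : palg n a) : R := \det (mulmat z).

End PrincipalAlgebra.

(* Main.v *)
(**
  Left multiplication is an algebra morphism into matrices that commutes with
  exp, so F(z) = rho^n det(exp B) where B is the matrix of
  v = k theta_1 + ... + k^(n-1) theta_(n-1). For 0 < l < n multiplication by k^l
  has zero diagonal in the basis of powers of k, so B has trace zero, and
  det(exp B) = 1.

  For the latter, exp B is the limit of (1 + B/m)^m: entrywise, its distance to
  the partial sum of the exponential series is at most the corresponding
  difference for the scalar exp N, N being a norm of B. Moreover, the
  characteristic polynomial gives det(1 + B/m) = 1 + tr B/m + O(1/m^2), whence
  det(1 + B/m)^m tends to 1 when tr B = 0.
*)
Require Import Defs.
From HB Require Import structures.
From mathcomp Require Import all_boot all_order all_algebra.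
From mathcomp Require Import all_classical all_reals all_analysis.
From mathcomp Require Import ring.

Set Implicit Arguments.
Unset Strict Implicit.
Unset Printing Implicit Defensive.

Import Order.TTheory GRing.Theory Num.Theory.
Import numFieldNormedType.Exports.
Local Open Scope classical_set_scope.
Local Open Scope ring_scope.

(** * Real sequences of the form (1 + u_m)^(m+1) *)

Section RealSequences.
Variable R : realType.

(** With h = 1/(m+1), the sequence is squeezed between [expR (x / (1 + x * h))] and [expR x]; each
    bound is an (m+1)-th power of an instance of 1 + y <= exp y. *)
Lemma cvg_1DM_harmonic_exp (x : R) : 0 <= x ->
  (1 + x * harmonic m) ^+ m.+1 @[m --> \oo] --> expR x.
Proof.
move=> x0.
have lower : expR (x * (1 + x * harmonic m)^-1) @[m --> \oo] --> expR x.
  apply: continuous_cvg; first exact: continuous_expR.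
  have : x * (1 + x * harmonic m)^-1 @[m --> \oo] --> x * (1 + x * 0)^-1.
    apply: cvgMl_tmp; apply: cvgV; first by rewrite mulr0 addr0 oner_eq0.
    by apply: cvgD; [exact: cvg_cst|apply: cvgMl_tmp; exact: cvg_harmonic].
  by rewrite mulr0 addr0 invr1 mulr1.
apply: squeeze_cvgr lower (cvg_cst _); apply: nearW => m.
set h := harmonic m; have h0 : 0 < h by rewrite /h /= invr_gt0.
have hm : h * m.+1%:R = 1 by rewrite /h /= mulVf.
have xh0 : 0 <= x * h by rewrite mulr_ge0 // ltW.
have xh1 : 0 < 1 + x * h by rewrite ltr_wpDr.
have E y : x * y = x * h * y * m.+1%:R.
  by rewrite (mulrAC x h) -(mulrA _ h) hm mulr1.
have -> : expR x = expR (x * h) ^+ m.+1.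
  by rewrite -expRM_natr -[in LHS](mulr1 x) E mulr1.
rewrite E expRM_natr.
(* [1 + y = 1 / (1 - y / (1 + y)) >= exp (y / (1 + y))] *)
apply/andP; split; apply: lerXn2r; rewrite ?nnegrE ?expR_ge0 ?(ltW xh1) //; last first.
  exact: expR_ge1Dx.
rewrite -lef_pV2 ?posrE ?expR_gt0 // -expRN.
apply: le_trans (expR_ge1Dx _).
suff -> : 1 + - (x * h * (1 + x * h)^-1) = (1 + x * h)^-1 by [].
apply: (mulIf (lt0r_neq0 xh1)); rewrite mulrDl mulNr mulfVK ?lt0r_neq0 //.
by rewrite mulVf ?lt0r_neq0 // mul1r addrK.
Qed.

(** The recursion (1 + y)^(m+1) - 1 = (1 + y) ((1 + y)^m - 1) + y, taken at y = x and at y = |x|,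
    shows by induction that passing to |x| can only enlarge the left side. Then 1 + |x| <= exp
    |x|. *)
Lemma normr_expr1D_sub1 (x : R) m :
  `|(1 + x) ^+ m - 1| <= expR (m%:R * `|x|) - 1.
Proof.
apply: (@le_trans _ _ ((1 + `|x|) ^+ m - 1)); last first.
  rewrite lerD2r expRM_natl.
  by apply: lerXn2r; rewrite ?nnegrE ?expR_ge0 ?addr_ge0 // expR_ge1Dx.
elim: m => [|m IH]; first by rewrite !expr0 subrr normr0.
rewrite !exprS.
have E (y : R) : (1 + y) * (1 + y) ^+ m - 1 = (1 + y) * ((1 + y) ^+ m - 1) + y.
  by ring.
rewrite !E (le_trans (ler_normD _ _)) // lerD2r normrM ler_pM //.
by rewrite (le_trans (ler_normD _ _)) // normr1.
Qed.

Lemma cvg_expr1D (u : R ^nat) : m.+1%:R * `|u m| @[m --> \oo] --> (0 : R) ->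
  (1 + u m) ^+ m.+1 @[m --> \oo] --> (1 : R).
Proof.
move=> u0; apply: (@cvg_sub0 _ _ _ _ _ _ (cst (1 : R))); last exact: cvg_cst.
apply/norm_cvg0P.
have upper : expR (m.+1%:R * `|u m|) - 1 @[m --> \oo] --> (0 : R).
  have : expR (m.+1%:R * `|u m|) - 1 @[m --> \oo] --> expR 0 - 1.
    apply: cvgB; last exact: cvg_cst.
    by apply: continuous_cvg => //; exact: continuous_expR.
  by rewrite expR0 subrr.
apply: squeeze_cvgr (cvg_cst 0) upper; apply: nearW => m.
by rewrite normr_ge0 normr_expr1D_sub1.
Qed.

End RealSequences.

(** * Entrywise limits of matrices and an entrywise norm *)

Section MatrixSequences.
Variables (R : realType) (n : nat).
Implicit Types A B : 'M[R]_n.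

Lemma cvg_sumr I (r : seq I) (f : I -> nat -> R) (l : I -> R) :
  (forall i, f i m @[m --> \oo] --> l i) ->
  \sum_(i <- r) f i m @[m --> \oo] --> \sum_(i <- r) l i.
Proof. by move=> fl; apply: cvg_big => //; exact: add_continuous. Qed.

Lemma cvg_prodr I (r : seq I) (f : I -> nat -> R) (l : I -> R) :
  (forall i, f i m @[m --> \oo] --> l i) ->
  \prod_(i <- r) f i m @[m --> \oo] --> \prod_(i <- r) l i.
Proof. by move=> fl; apply: cvg_big => //; exact: mul_continuous. Qed.

Lemma cvg_mx p q (f : nat -> 'M[R]_(p, q)) (L : 'M[R]_(p, q)) :
  (forall i j, f m i j @[m --> \oo] --> L i j) -> f m @[m --> \oo] --> L.
Proof.
move=> fL; apply/cvg_mx_entourageP => E entE.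
apply: filter_forall => i; apply: filter_forall => j.
have /cvg_app_entourageP /(_ E entE) := fL i j.
by apply: filterS => m; rewrite /= inE.
Qed.

Lemma cvg_det (f : nat -> 'M[R]_n) (L : 'M[R]_n) :
  (forall i j, f m i j @[m --> \oo] --> L i j) ->
  \det (f m) @[m --> \oo] --> \det L.
Proof.
move=> fL; apply: cvg_sumr => s; apply: cvgMl_tmp.
by apply: cvg_prodr => i; exact: fL.
Qed.

(** Summing over all entries makes this dominate every column sum, which is what the induction on
    powers needs. *)
Definition mxnorm1 A : R := \sum_i \sum_j `|A i j|.

Lemma mxnorm1_ge0 A : 0 <= mxnorm1 A.
Proof. by apply: sumr_ge0 => i _; apply: sumr_ge0. Qed.

Lemma normr_exprmx_le A k i j : `|(A ^+ k) i j| <= mxnorm1 A ^+ k.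
Proof.
elim: k i j => [|k IH] i j.
  by rewrite !expr0 mxE; case: eqP; rewrite ?normr1 ?normr0.
rewrite !exprSr mxE (le_trans (ler_norm_sum _ _ _)) //.
rewrite /mxnorm1 mulr_sumr ler_sum // => l _; rewrite normrM ler_pM //.
by rewrite (bigD1 j) //= lerDl sumr_ge0.
Qed.

(** * The matrix exponential, as a series and as a limit of powers *)

Definition expmx_coeff A (i j : 'I_n) : R ^nat :=
  fun k => k`!%:R^-1 * (A ^+ k) i j.

Definition expmx A : 'M[R]_n :=
  \matrix_(i, j) limn (series (expmx_coeff A i j)).

Lemma is_cvg_series_expmx_coeff A i j : cvgn (series (expmx_coeff A i j)).
Proof.
apply: normed_cvg.
apply: (series_le_cvg _ _ _ (is_cvg_series_exp_coeff (mxnorm1 A))) => k //=.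
  exact/exp_coeff_ge0/mxnorm1_ge0.
by rewrite /exp_coeff /= normrM ger0_norm ?invr_ge0 // mulrC ler_wpM2r ?invr_ge0
  ?normr_exprmx_le.
Qed.

Lemma cvg_series_expmx_coeff A i j :
  series (expmx_coeff A i j) @ \oo --> expmx A i j.
Proof. by rewrite mxE; exact: is_cvg_series_expmx_coeff. Qed.

(** After clearing denominators, this says that the falling factorial p (p-1) ... (p-k+1) is at most
    p^k, for p = m+1. *)
Lemma bin_harmonic_le m k : 'C(m.+1, k)%:R * harmonic m ^+ k <= k`!%:R^-1 :> R.
Proof.
rewrite /harmonic /= exprVn ler_pdivrMr ?exprn_gt0 // mulrC.
rewrite ler_pdivlMr ?ltr0n ?fact_gt0 // -natrX -natrM ler_nat bin_ffact.
elim: k (m.+1) => [|k IH] p; first by rewrite expn0 ffactn0.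
rewrite ffactnS expnS leq_mul //; apply: leq_trans (IH _) _.
by case: k {IH} => // k; rewrite leq_exp2r ?leq_pred.
Qed.

Lemma exprD1n_harmonic (A : 'M[R]_n) m :
  (1 + harmonic m *: A) ^+ m.+1 =
  \sum_(k < m.+2) ('C(m.+1, k)%:R * harmonic m ^+ k) *: A ^+ k.
Proof.
rewrite addrC exprD1n; apply: eq_bigr => k _.
rewrite mulr_natl -scalerMnl; congr (_ *+ _).
elim: (k : nat) => [|p IH]; first by rewrite !expr0 scale1r.
by rewrite !exprS IH -[LHS]scalemxAl -scalemxAr scalerA.
Qed.

Lemma cvg_expr_expmx A i j :
  ((1 + harmonic m *: A) ^+ m.+1) i j @[m --> \oo] --> expmx A i j.
Proof.
set N := mxnorm1 A; have N0 : 0 <= N := mxnorm1_ge0 A.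
(* The binomial expansion of an (m+1)-th power has m+2 terms, so it is compared term by term with
   the partial sum of the same length. *)
pose S m := series (expmx_coeff A i j) m.+2.
have Scvg : S m @[m --> \oo] --> expmx A i j.
  rewrite /S (cvg_shiftS (fun m => series (expmx_coeff A i j) m.+1)).
  rewrite (cvg_shiftS (series (expmx_coeff A i j))).
  exact: cvg_series_expmx_coeff.
apply: (@cvg_sub0 _ _ _ _ _ _ S) Scvg; apply/norm_cvg0P.
have upper : series (exp_coeff N) m.+2 - (1 + N * harmonic m) ^+ m.+1
    @[m --> \oo] --> (0 : R).
  rewrite -(subrr (expR N)); apply: cvgB; last exact: cvg_1DM_harmonic_exp.
  rewrite (cvg_shiftS (fun m => series (exp_coeff N) m.+1)).
  rewrite (cvg_shiftS (series (exp_coeff N))).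
  exact: is_cvg_series_exp_coeff.
apply: squeeze_cvgr (cvg_cst 0) upper; apply: nearW => m.
rewrite normr_ge0 /=.
rewrite -[leLHS]/(`|((1 + harmonic m *: A) ^+ m.+1) i j - S m|).
rewrite exprD1n_harmonic summxE /S /series /= !big_mkord -sumrB.
rewrite (addrC 1) exprD1n -sumrB (le_trans (ler_norm_sum _ _ _)) // ler_sum // => k _.
(* The matrix and the scalar differences share the coefficients 1/k! - C(m+1,k)/(m+1)^k. As these
   are nonnegative, it remains to bound the entries of A^k by N^k. *)
rewrite mxE -mulrBl normrM distrC (ger0_norm (_ : 0 <= _ - _)); last first.
  by rewrite subr_ge0 bin_harmonic_le.
have -> : exp_coeff N k - (N * harmonic m) ^+ k *+ 'C(m.+1, k) =
    (k`!%:R^-1 - 'C(m.+1, k)%:R * harmonic m ^+ k) * N ^+ k.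
  by rewrite exprMn -mulr_natl mulrBl /exp_coeff /= mulrC [N ^+ k * _]mulrC mulrA.
by rewrite ler_wpM2l ?subr_ge0 ?bin_harmonic_le ?normr_exprmx_le.
Qed.

(** * Determinants near the identity and the exponential of a traceless matrix *)

Lemma horner_char_poly A y : (char_poly A).[y] = \det (y%:M - A).
Proof.
rewrite -[LHS]/(horner_eval y _) -det_map_mx; congr (\det _).
apply/matrixP => i j; rewrite !mxE /= /horner_eval !hornerE hornerMn hornerX.
by [].
Qed.

(** Let c_k be the coefficients of the characteristic polynomial of -A. Reversing it gives det(1 +
    xA) = sum of c_k x^(n-k), where c_n = 1 and c_(n-1) = tr A = 0. The other terms have degree at
    least 2 in x, hence are at most |c_k| x^2 for 0 < x <= 1. *)
Lemma det_1D_trace0 A : (0 < n)%N -> \tr A = 0 ->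
  exists C, forall x, 0 < x <= 1 -> `|\det (1 + x *: A) - 1| <= C * x ^+ 2.
Proof.
move=> n0 trA; pose c k := (char_poly (- A))`_k.
exists (\sum_(k < n.-1) `|c k|) => x /andP[x0 x1].
have -> : 1 + x *: A = x *: (x^-1%:M - - A).
  by rewrite opprK scalerDr scale_scalar_mx mulfV ?gt_eqF.
rewrite detZ -horner_char_poly horner_coef size_char_poly mulr_sumr.
have -> : \sum_(k < n.+1) x ^+ n * (c k * x^-1 ^+ k) =
    \sum_(k < n.+1) c k * x ^+ (n - k).
  apply: eq_bigr => k _; rewrite mulrCA; congr (_ * _).
  by rewrite exprVn expfB_cond // gt_eqF // -ltnS ltn_ord.
have := monicP (char_poly_monic (- A)); rewrite lead_coefE size_char_poly /=.
have := char_poly_trace (- A) n0; rewrite raddfN /= trA !oppr0 -!/(c _).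
(* With [c] opaque, nothing left in the goal depends on [A], so n can be split as p+1 and the two
   top terms peeled off. *)
clearbody c; move: (n) n0 => [|p] //= _ c1 c0.
rewrite !big_ord_recr /= c0 c1 subnn mul0r addr0 mulr1 addrK.
rewrite mulr_suml (le_trans (ler_norm_sum _ _ _)) // ler_sum // => k _.
rewrite normrM ler_wpM2l // ger0_norm ?exprn_ge0 ?(ltW x0) //.
by apply: ler_wiXn2l; rewrite ?(ltW x0) // ltn_subRL addn1 ltnS.
Qed.

Lemma cvg_det_1D_harmonic A : (0 < n)%N -> \tr A = 0 ->
  \det (1 + harmonic m *: A) ^+ m.+1 @[m --> \oo] --> (1 : R).
Proof.
move=> n0 trA; have [C detC] := det_1D_trace0 n0 trA.
have -> : (fun m => \det (1 + harmonic m *: A) ^+ m.+1) =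
    (fun m => (1 + (\det (1 + harmonic m *: A) - 1)) ^+ m.+1).
  by apply/funext => m; rewrite subrKC.
apply: cvg_expr1D.
have upper : C * harmonic m @[m --> \oo] --> (0 : R).
  by rewrite -(mulr0 C); apply: cvgMl_tmp; exact: cvg_harmonic.
apply: squeeze_cvgr (cvg_cst 0) upper; apply: nearW => m.
(* The quadratic bound C h^2, multiplied by m+1 = 1/h, leaves C h. *)
rewrite mulr_ge0 //= -ler_pdivlMl ?ltr0n // mulrCA -expr2.
by apply: detC; rewrite invr_gt0 ltr0n /= invf_le1 ?ler1n ?ltr0n.
Qed.

Lemma det_expmx_trace0 A : (0 < n)%N -> \tr A = 0 -> \det (expmx A) = 1.
Proof.
move=> n0 trA.
have detX m : \det ((1 + harmonic m *: A) ^+ m.+1) =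
    \det (1 + harmonic m *: A) ^+ m.+1.
  by elim: m.+1 => [|p IH]; rewrite ?expr0 ?det1 // !exprS -IH -det_mulmx.
have := cvg_det (@cvg_expr_expmx A); under eq_cvg do rewrite detX.
by move/(cvg_unique (@norm_hausdorff _ _)); apply; exact: cvg_det_1D_harmonic.
Qed.

End MatrixSequences.

(** * The basis of powers of k *)

Section PrincipalAlgebraTheory.
Variables (R : realType) (n : nat) (a : R).
Hypothesis n_gt0 : (0 < n)%N.
Local Notation k := (pgen n a).
Local Notation beta := (pbasis n a).
Implicit Types z w : palg n a.

Lemma mk_monic_palg : mk_monic ('X^n - a%:P) = 'X^n - a%:P.
Proof. by rewrite /mk_monic size_XnsubC // monicXnsubC // ltnS n_gt0. Qed.

Lemma size_mk_monic_palg : size (mk_monic ('X^n - a%:P)) = n.+1.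
Proof. by rewrite mk_monic_palg size_XnsubC. Qed.

Lemma pgen_exp (i : nat) : k ^+ i = in_qpoly _ 'X^i.
Proof. by rewrite rmorphXn. Qed.

Lemma pgen_expn : k ^+ n = a%:A.
Proof.
have mod0 : in_qpoly ('X^n - a%:P) ('X^n - a%:P) = 0.
  by apply: val_inj; rewrite /= mk_monic_palg Pdiv.RingMonic.rmodpp // monicXnsubC.
rewrite pgen_exp -[X in in_qpoly _ X](subrK a%:P) in_qpolyD mod0 add0r.
by rewrite -[a%:P]mulr1 mul_polyC in_qpolyZ in_qpoly1.
Qed.

Lemma pgen_exp_small (i : nat) : (i < n)%N -> k ^+ i = 'X^i :> {poly R}.
Proof.
by move=> lt_in; rewrite pgen_exp in_qpoly_small // size_polyXn size_mk_monic_palg.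
Qed.

Lemma tnth_pbasis (i : 'I_n) : tnth beta i = k ^+ i.
Proof. by rewrite tnth_mktuple. Qed.

Lemma nth_pbasis (i : 'I_n) : beta`_i = k ^+ i.
Proof. by rewrite -tnth_nth tnth_pbasis. Qed.

(** Below degree n no reduction takes place: k^j is represented by X^j itself, so coordinates are
    polynomial coefficients. Freeness of the basis follows. *)
Lemma coef_sum_pbasis (c : 'I_n -> R) (i : 'I_n) :
  (\sum_(j < n) c j *: k ^+ j : {poly R})`_i = c i.
Proof.
rewrite poly_of_qpoly_sum coef_sum (bigD1 i) //= coefZ pgen_exp_small //.
rewrite coefXn eqxx mulr1 big1 ?addr0 // => j ne_ji.
rewrite coefZ pgen_exp_small // coefXn eq_sym.
by move: ne_ji; rewrite -val_eqE => /negPf ->; rewrite mulr0.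
Qed.

Lemma pbasisP : basis_of fullv beta.
Proof.
rewrite basisEfree subvf size_tuple andTb; apply/andP; split; last first.
  by rewrite dim_polyn size_mk_monic_palg.
apply/freeP => c c0 i; rewrite -[LHS](coef_sum_pbasis c).
move: c0; under eq_bigr do rewrite nth_pbasis.
by move=> ->; rewrite coef0.
Qed.

Lemma sum_coord_pbasis z : z = \sum_(i < n) coord beta i z *: k ^+ i.
Proof.
rewrite [LHS](coord_basis pbasisP) ?memvf //.
by apply: eq_bigr => i _; rewrite nth_pbasis.
Qed.

Lemma coord_pbasisX (i : 'I_n) j : (j < n)%N ->
  coord beta i (k ^+ j) = (i == j :> nat)%:R.
Proof.
move=> lt_jn; have := coord_free (Ordinal lt_jn) i (basis_free pbasisP).
by rewrite nth_pbasis eq_sym.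
Qed.

(** * Multiplication matrices, their traces and their exponentials *)

Lemma mulmatD : {morph @mulmat R n a : z w / z + w}.
Proof. by move=> z w; apply/matrixP => i j; rewrite !mxE mulrDl linearD. Qed.

Lemma mulmatZ c : {morph @mulmat R n a : z / c *: z}.
Proof. by move=> z; apply/matrixP => i j; rewrite !mxE -scalerAl linearZ. Qed.

Lemma mulmat0 : mulmat (0 : palg n a) = 0.
Proof. by rewrite -(scale0r 0) mulmatZ scale0r. Qed.

Lemma mulmat_sum I (r : seq I) (F : I -> palg n a) :
  mulmat (\sum_(i <- r) F i) = \sum_(i <- r) mulmat (F i).
Proof. exact: (big_morph _ mulmatD mulmat0). Qed.

Lemma mulmat1 : mulmat (1 : palg n a) = 1.
Proof.
by apply/matrixP => i j; rewrite !mxE mul1r tnth_pbasis coord_pbasisX ?ltn_ord.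
Qed.

Lemma mulmatM z w : mulmat (z * w) = mulmat z * mulmat w.
Proof.
apply/matrixP => i j; rewrite !mxE -mulrA.
rewrite [w * _]sum_coord_pbasis mulr_sumr linear_sum; apply: eq_bigr => l _ /=.
by rewrite -scalerAr linearZ /= !mxE mulrC !tnth_pbasis.
Qed.

Lemma mulmatX z m : mulmat (z ^+ m) = mulmat z ^+ m.
Proof. by elim: m => [|m IH]; rewrite ?mulmat1 // !exprS mulmatM IH. Qed.

(** Column 0 holds the coordinates of z * k^0 = z. This turns the coordinate series defining [pexp]
    into column 0 of the matrix series. *)
Lemma coord_mulmat z i : coord beta i z = mulmat z i (Ordinal n_gt0).
Proof. by rewrite mxE tnth_pbasis mulr1. Qed.

Lemma pdetZ c z : pdet (c *: z) = c ^+ n * pdet z.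
Proof. by rewrite /pdet mulmatZ detZ. Qed.

(** The product k^l k^i is k^(l+i) or a k^(l+i-n). Since 0 < l < n, neither exponent equals i, so
    every diagonal entry vanishes, whatever a is. *)
Lemma trace_mulmat_pgen_exp l : (0 < l < n)%N -> \tr (mulmat (k ^+ l)) = 0.
Proof.
move=> /andP[l0 ln]; apply: big1 => i _; rewrite mxE tnth_pbasis -exprD.
have [lt_lin|le_nli] := ltnP (l + i) n.
  by rewrite coord_pbasisX // -[X in X == _]add0n eqn_add2r eq_sym gtn_eqF.
rewrite -(subnKC le_nli) exprD pgen_expn -scalerAl mul1r linearZ /=.
rewrite coord_pbasisX; last first.
  by rewrite ltn_subLR // -addnS leq_add // ltnW.
suff /negPf -> : i != (l + i - n)%N :> nat by rewrite mulr0.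
by rewrite neq_ltn orbC ltn_subLR // ltn_add2r ln.
Qed.

Lemma pcoords_series z N :
  pcoords (series (fun m : nat => m`!%:R^-1 *: z ^+ m) N) =
  \row_i series (expmx_coeff (mulmat z) i (Ordinal n_gt0)) N.
Proof.
apply/rowP => i; rewrite !mxE /series /= linear_sum; apply: eq_bigr => m _ /=.
by rewrite linearZ /= coord_mulmat mulmatX.
Qed.

(** Both sides are limits of [mulmat] at the partial sums of the series. Each entry of [mulmat] is a
    finite linear combination of coordinates, so it passes to the limit; uniqueness of limits
    concludes. *)
Lemma mulmat_pexp z : mulmat (pexp z) = expmx (mulmat z).
Proof.
have lim_row : limn (fun N : nat =>
    pcoords (series (fun m : nat => m`!%:R^-1 *: z ^+ m) N)) =
    \row_i expmx (mulmat z) i (Ordinal n_gt0).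
  apply: cvg_lim; first exact: norm_hausdorff.
  apply: cvg_mx => i j; under eq_cvg do rewrite pcoords_series mxE.
  by rewrite mxE; exact: cvg_series_expmx_coeff.
rewrite /pexp lim_row mulmat_sum; apply/matrixP => i j.
have cvgl : \sum_(l < n)
    series (expmx_coeff (mulmat z) l (Ordinal n_gt0)) N * mulmat (k ^+ l) i j
    @[N --> \oo] -->
    \sum_(l < n) expmx (mulmat z) l (Ordinal n_gt0) * mulmat (k ^+ l) i j.
  by apply: cvg_sumr => l; apply: cvgMr_tmp; exact: cvg_series_expmx_coeff.
have -> : (\sum_(l < n) mulmat ((\row_i0 expmx (mulmat z) i0 (Ordinal n_gt0)) 0 l *:
      tnth beta l)) i j =
    \sum_(l < n) expmx (mulmat z) l (Ordinal n_gt0) * mulmat (k ^+ l) i j.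
  rewrite summxE; apply: eq_bigr => l _.
  by rewrite tnth_pbasis mulmatZ [LHS]mxE; congr (_ * _); rewrite mxE.
(* The N-th partial sum is expanded in two ways: in the basis, and as a sum of powers, which
   [mulmat] respects. *)
have E N : \sum_(l < n)
    series (expmx_coeff (mulmat z) l (Ordinal n_gt0)) N * mulmat (k ^+ l) i j =
    series (expmx_coeff (mulmat z) i j) N.
  transitivity (mulmat (series (fun m : nat => m`!%:R^-1 *: z ^+ m) N) i j).
    rewrite [in RHS](sum_coord_pbasis (series _ N)) mulmat_sum summxE.
    apply: eq_bigr => l _; rewrite mulmatZ [RHS]mxE; congr (_ * _).
    by have /rowP/(_ l) := pcoords_series z N; rewrite !mxE.
  rewrite /series /= mulmat_sum summxE; apply: eq_bigr => m _.
  by rewrite mulmatZ mulmatX mxE.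
move: cvgl; under eq_cvg do rewrite E.
by move/(cvg_unique (@norm_hausdorff _ _)); apply; exact: cvg_series_expmx_coeff.
Qed.

Lemma pdet_pexp_pgen (theta : 'I_n.-1 -> R) :
  pdet (pexp (\sum_(i < n.-1) theta i *: k ^+ i.+1)) = 1.
Proof.
rewrite /pdet mulmat_pexp det_expmx_trace0 // mulmat_sum raddf_sum big1 // => i _.
rewrite mulmatZ /= mxtraceZ trace_mulmat_pgen_exp ?mulr0 //=.
by rewrite -ltn_predRL.
Qed.

End PrincipalAlgebraTheory.

Theorem corollary2p7 (R : realType) (n : nat) (hn : (0 < n)%N) (a : R)
    (z : palg n a) (hz : Ld z) (rho : R) (theta : 'I_n.-1 -> R)
    (hpolar : polar_form z rho theta) :
  [/\ 0 < rho,
      pdet z = rho ^+ n,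
      (forall r : R, 0 < r -> pdet z = r ^+ n -> r = rho)
    & rho = pdet z `^ n%:R^-1].
Proof.
case: hpolar => rho0 ->; rewrite pdetZ pdet_pexp_pgen // mulr1.
split => //.
  (* Uniqueness is injectivity of the n-th power on nonnegative reals, for n > 0. *)
  move=> r r0 E; apply: (pexpIrn hn); rewrite ?nnegrE ?ltW //.
by rewrite -powR_mulrn ?ltW // -powRrM mulfV ?powRr1 ?ltW // pnatr_eq0 -lt0n.
Qed.
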